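(* Let $G$ be a group and let $A$ be a finite set with $|A|\ge 2$. Then $\mathrm{IGCA}(G;A) \cong \mathrm{ICA}(G;A) \rtimes \mathrm{Aut}(G)^{\mathrm{op}}$.
   Context: $A^G$ is the set of all functions $x : G \to A$, with the shift action $(g\cdot x)(h) := x(g^{-1}h)$ for $x \in A^G$, $g,h\in G$. For an endomorphism $\phi$ of $G$, a function $\tau : A^G \to A^G$ is a $\phi$-cellular automaton if there are a finite subset $S \subseteq G$ and a function $\mu : A^S \to A$ such that $\tau(x)(g) = \mu((\phi(g^{-1})\cdot x)|_S)$ for all $x \in A^G$, $g \in G$. $\mathrm{IGCA}(G;A)$ is the group, under composition, of all bijective functions $\tau : A^G\to A^G$ that are $\phi$-cellular automata for some $\phi \in \mathrm{Aut}(G)$. $\mathrm{ICA}(G;A)$ is the group, under composition, of all bijective $\mathrm{id}_G$-cellular automata $A^G \to A^G$ (this is the group of units of the monoid of all $\mathrm{id}_G$-cellular automata). $\mathrm{Aut}(G)^{\mathrm{op}}$ is the group with underlying set $\mathrm{Aut}(G)$ and operation $\phi\odot\psi := \psi\circ\phi$. It is identified with the subgroup $\{\phi^\star : \phi\in\mathrm{Aut}(G)\}$ of $\mathrm{IGCA}(G;A)$ via $\phi\mapsto\phi^\star$, where $\phi^\star(x) := x\circ\phi$ for $x \in A^G$. Semidirect product convention: a group $K$ is the semidirect product of two subgroups $N$ and $B$, written $K \cong N\rtimes B$, if $K = NB$, $N$ is normal in $K$, and $N\cap B = \{e_K\}$. *)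

(* Defs.v *)
From HB Require Import structures.
From mathcomp Require Import all_boot finmap.
From mathcomp Require Import boolp classical_sets.

Set Implicit Arguments.
Unset Strict Implicit.
Unset Printing Implicit Defensive.

Local Open Scope group_scope.

(* A groupType is an arbitrary, possibly infinite, group; the choiceType
   structure it carries is no restriction classically. *)

Section Symmetric.
Variable T : Type.

Record Sym := MkSym {
  sym_fun :> T -> T;
  sym_bij : bijective sym_fun
}.

HB.instance Definition _ := gen_eqMixin Sym.
HB.instance Definition _ := gen_choiceMixin Sym.

Lemma symP (f g : Sym) : sym_fun f = sym_fun g -> f = g.
Proof.
case: f g => [f fP] [g gP] /= fg; case: _ / fg in gP *.
by congr MkSym; exact: Prop_irrelevance.
Qed.

Definition sym1 : Sym := @MkSym idfun (inv_bij (fun=> erefl)).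

(* The product is composition of functions: (f * g) x = f (g x). *)
Definition symM (f g : Sym) : Sym := MkSym (bij_comp (sym_bij f) (sym_bij g)).

Lemma symV_subproof (f : Sym) :
  {g : T -> T | bijective g & cancel f g /\ cancel g f}.
Proof.
apply: cid2; case: (sym_bij f) => g fK gK.
by exists g => //; exists (sym_fun f).
Qed.

Definition symV (f : Sym) : Sym := MkSym (s2valP (symV_subproof f)).

Lemma symVK (f : Sym) : cancel f (symV f) /\ cancel (symV f) f.
Proof. exact: (s2valP' (symV_subproof f)). Qed.

Fact symMA : associative symM. Proof. by move=> f g h; exact: symP. Qed.
Fact sym1M : left_id sym1 symM. Proof. by move=> f; exact: symP. Qed.
Fact symM1 : right_id sym1 symM. Proof. by move=> f; exact: symP. Qed.
Fact symVM : left_inverse sym1 symV symM.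
Proof. by move=> f; apply/symP/funext => x /=; exact: (symVK f).1. Qed.
Fact symMV : right_inverse sym1 symV symM.
Proof. by move=> f; apply/symP/funext => x /=; exact: (symVK f).2. Qed.

HB.instance Definition _ := isGroup.Build Sym symMA sym1M symM1 symVM symMV.

End Symmetric.

Section Automorphisms.
Variable G : groupType.

Record Aut := MkAut {
  aut_mor :> {multiplicative G -> G};
  aut_bij : bijective aut_mor
}.

HB.instance Definition _ := gen_eqMixin Aut.
HB.instance Definition _ := gen_choiceMixin Aut.

Lemma autP (f g : Aut) : (f : G -> G) = (g : G -> G) -> f = g.
Proof.
case: f g => [[f [[fM]]] fP] [[g [[gM]]] gP] /= fg.
case: _ / fg in gM gP *.
have -> : fM = gM by exact: Prop_irrelevance.
by congr MkAut; exact: Prop_irrelevance.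
Qed.

Definition aut1 : Aut :=
  @MkAut (idfun : {multiplicative G -> G}) (inv_bij (fun=> erefl)).

Definition autM (f g : Aut) : Aut :=
  @MkAut (f \o g : {multiplicative G -> G}) (bij_comp (aut_bij f) (aut_bij g)).

Lemma autV_subproof (f : Aut) :
  {g : {multiplicative G -> G} | bijective g & cancel f g /\ cancel g f}.
Proof.
apply: cid2; case: (aut_bij f) => g fK gK.
pose gM := isMultiplicative.Build G G g (can2_gmulfM fK gK).
pose g' : {multiplicative G -> G} := HB.pack g gM.
by exists g' => //; exists (aut_mor f).
Qed.

Definition autV (f : Aut) : Aut := MkAut (s2valP (autV_subproof f)).

Lemma autVK (f : Aut) : cancel f (autV f) /\ cancel (autV f) f.
Proof. exact: (s2valP' (autV_subproof f)). Qed.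

Fact autMA : associative autM. Proof. by move=> f g h; exact: autP. Qed.
Fact aut1M : left_id aut1 autM. Proof. by move=> f; exact: autP. Qed.
Fact autM1 : right_id aut1 autM. Proof. by move=> f; exact: autP. Qed.
Fact autVM : left_inverse aut1 autV autM.
Proof. by move=> f; apply/autP/funext => x /=; exact: (autVK f).1. Qed.
Fact autMV : right_inverse aut1 autV autM.
Proof. by move=> f; apply/autP/funext => x /=; exact: (autVK f).2. Qed.

HB.instance Definition _ := isGroup.Build Aut autMA aut1M autM1 autVM autMV.

End Automorphisms.

Definition opposite (H : Type) : Type := H.

Section Opposite.
Variable H : groupType.

HB.instance Definition _ := Choice.copy (opposite H) H.

Definition oppositeM (f g : opposite H) : opposite H := (g : H) * (f : H).

Fact oppositeMA : associative oppositeM.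
Proof. by move=> f g h; rewrite /oppositeM mulgA. Qed.
Fact opposite1M : left_id (1 : H) oppositeM.
Proof. by move=> f; rewrite /oppositeM mulg1. Qed.
Fact oppositeM1 : right_id (1 : H) oppositeM.
Proof. by move=> f; rewrite /oppositeM mul1g. Qed.
Fact oppositeVM : left_inverse (1 : H) (@inv H) oppositeM.
Proof. by move=> f; rewrite /oppositeM mulgV. Qed.
Fact oppositeMV : right_inverse (1 : H) (@inv H) oppositeM.
Proof. by move=> f; rewrite /oppositeM mulVg. Qed.

HB.instance Definition _ := isGroup.Build (opposite H)
  oppositeMA opposite1M oppositeM1 oppositeVM oppositeMV.

End Opposite.

Section SemidirectProduct.
Variable H : groupType.
Implicit Types K N B : set H.
Local Open Scope classical_set_scope.

Definition subgroup K : Prop := group_closed [in K].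

Definition normal_in N K : Prop :=
  forall k n, K k -> N n -> N (k * n * k^-1).

(* K is the (internal) semidirect product of N and B, all three being
   subgroups of an ambient group. *)
Record semidirect_product K N B : Prop := {
  sdprod_group : subgroup K;
  sdprod_subl : subgroup N /\ N `<=` K;
  sdprod_subr : subgroup B /\ B `<=` K;
  sdprod_mul : K = [set n * b | n in N & b in B];
  sdprod_normal : normal_in N K;
  sdprod_trivI : N `&` B = [set 1]
}.

End SemidirectProduct.

Section CellularAutomata.
Variables (G : groupType) (A : finType).

Definition gshift (g : G) (x : G -> A) : G -> A := fun h => x (g^-1 * h).

Definition restriction (S : {fset G}) (x : G -> A) : S -> A :=
  fun s => x (val s).

Arguments restriction : clear implicits.

Definition cellular_automaton (phi : {multiplicative G -> G})
    (tau : (G -> A) -> (G -> A)) : Prop :=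
  exists (S : {fset G}) (mu : (S -> A) -> A),
    forall (x : G -> A) (g : G),
      tau x g = mu (restriction S (gshift (phi g^-1) x)).

Definition IGCA : set (Sym (G -> A)) :=
  [set tau | exists phi : Aut G, cellular_automaton phi tau]%classic.

Definition ICA : set (Sym (G -> A)) :=
  [set tau | cellular_automaton idfun tau]%classic.

Definition star_fun (phi : G -> G) (x : G -> A) : G -> A := x \o phi.

Fact star_bij (phi : Aut G) : bijective (star_fun phi).
Proof.
have [phiK phiVK] := autVK phi.
by exists (star_fun (autV phi)) => x; apply/funext => g;
  rewrite /star_fun /= ?phiK ?phiVK.
Qed.

Definition star (phi : opposite (Aut G)) : Sym (G -> A) :=
  MkSym (star_bij phi).

End CellularAutomata.

Arguments IGCA : clear implicits.
Arguments ICA : clear implicits.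
Arguments star : clear implicits.

(* Main.v *)
Require Import Defs.
From mathcomp Require Import all_boot finmap.
From mathcomp Require Import boolp classical_sets filter.

(** The group part is formal once two facts about a [phi]-cellular automaton
    [tau] are known: if [sigma] is a [psi]-cellular automaton, then
    [tau \o sigma] is one for [psi \o phi] ([ca_comp]); and if [tau] and [phi]
    are bijective, then [tau^-1] is one for [phi^-1] ([ca_inv]).  Hence [IGCA]
    and [ICA] are groups, and conjugating an ordinary automaton by [tau] gives
    one for [phi^-1 \o id \o phi = id], so [ICA] is normal.  Since [star phi]
    is a [phi]-cellular automaton with memory set [{1}], the product
    [tau * star (phi^-1)] is an ordinary automaton, which gives the
    factorisation.  Finally [star phi] preserves the value at [1]; an ordinary
    automaton commutes with all translations, so if it preserves the value at
    [1] it is the identity ([ca_fix1_id]), whence the trivial intersection.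

    Both facts become transparent through the description of Curtis, Hedlund
    and Lyndon ([caP]): a map is a [phi]-cellular automaton iff it intertwines
    the translation by [phi g] with the translation by [g], for every [g], and
    each cell of its value reads only finitely many cells.  The delicate point is
    that the latter property passes to inverses.  It amounts to continuity for
    the product topology of the compact space of configurations, where a
    continuous bijection is a homeomorphism; [local_inv] extracts the limits
    it needs directly from an ultrafilter on the finite subsets of [G], so that
    the group [G] may be uncountable. *)

Set Implicit Arguments.
Unset Strict Implicit.
Unset Printing Implicit Defensive.

Local Open Scope group_scope.

(** * Multiplicative maps between groups *)

Section GroupMorphism.
Variables (G H : groupType) (f : G -> H).
Hypothesis fM : {morph f : x y / x * y}.

Lemma groupmorph1 : f 1 = 1.
Proof. by apply: (mulgI (f 1)); rewrite -fM !mulg1. Qed.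

Lemma groupmorphV : {morph f : x / x^-1}.
Proof. by move=> x; apply: (mulgI (f x)); rewrite -fM !mulgV groupmorph1. Qed.

End GroupMorphism.

(** * Maps whose values read finitely many cells *)

Section Local.
Variable I : choiceType.

(** Continuity, when [A] and [B] are discrete, [A] is finite and the
    configurations [I -> A] carry the product topology. *)
Definition finitely_determined (A B : Type) (F : (I -> A) -> B) : Prop :=
  exists S : {fset I}, forall x y, {in S, x =1 y} -> F x = F y.

Definition local (A B : Type) (tau : (I -> A) -> (I -> B)) : Prop :=
  forall i, finitely_determined (fun x => tau x i).

(** A finite set of cells of [tau x] reads a finite union of finite sets. *)
Lemma finitely_determined_comp (A B C : Type) (F : (I -> B) -> C)
    (tau : (I -> A) -> (I -> B)) :
  finitely_determined F -> local tau -> finitely_determined (F \o tau).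
Proof.
move=> [S FS] /choice[T tauT].
exists (\bigcup_(s <- S) T s)%fset => x y xy; apply: FS => s sS.
apply: tauT => t tT; apply: xy.
by apply/bigfcupP; exists s => //; rewrite sS.
Qed.

(** Compactness of a finite discrete space: if no value were a limit, the
    ultrafilter would contain the finitely many sets [f <> a], whose
    intersection is empty. *)
Lemma ultrafilter_limit (T : Type) (U : set_system T) (A : finType)
    (f : T -> A) :
  UltraFilter U -> exists a, U [set t | f t = a]%classic.
Proof.
move=> UU; apply: contrapT => /forallNP noa.
have PU : ProperFilter U by exact: ultra_proper.
have UC a : U [set t | f t <> a]%classic.
  by have [/noa|] := in_ultra_setVsetC [set t | f t = a]%classic UU.
by have [t /(_ (f t))] := filter_ex (filter_forall _ UC).
Qed.

(** The tails of the directed set of finite subsets of [I] generate a proper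
    filter, which an ultrafilter refines. *)
Lemma ultrafilter_fset :
  exists2 U : set_system {fset I}, UltraFilter U &
    forall T, U [set S | (T `<=` S)%fset]%classic.
Proof.
pose F : set_system {fset I} := fun P =>
  exists T, forall S : {fset I}, (T `<=` S)%fset -> P S.
have PF : ProperFilter F.
  apply: Build_ProperFilter => [[T /(_ T)]|]; first by apply.
  split; first by exists fset0.
  - move=> P Q [T TP] [T' TQ]; exists (T `|` T')%fset => S.
    by rewrite fsubUset => /andP[/TP ? /TQ].
  - by move=> P Q PQ [T TP]; exists T => S /TP/PQ.
have [U [UU FU]] := ultraFilterLemma PF.
by exists U => // T; apply: FU; exists T.
Qed.

(** If the cell [i] of [sigma] were not finitely determined, every finite [T]
    would carry two configurations [xT] and [x'T] with distinct values at [i]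
    and images under [tau] that agree on [T].  Their limits along an
    ultrafilter still differ at [i], and have the same image since each cell
    of that image reads finitely many cells: [tau] would not be injective. *)
Lemma local_inv (A : finType) (B : Type) (tau : (I -> A) -> (I -> B))
    (sigma : (I -> B) -> (I -> A)) :
  cancel tau sigma -> cancel sigma tau -> local tau -> local sigma.
Proof.
move=> tauK sigmaK tau_loc i; apply: contrapT => nloc.
have /choice[p pP] (T : {fset I}) : exists p : (I -> A) * (I -> A),
    {in T, tau p.1 =1 tau p.2} /\ p.1 i <> p.2 i.
  apply: contrapT => nP; apply: nloc; exists T => y y' yy'.
  apply: contrapT => neq; apply: nP; exists (sigma y, sigma y') => /=.
  by rewrite !sigmaK.
have [U UU Utail] := ultrafilter_fset.
have PU : ProperFilter U by exact: ultra_proper.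
have /choice[x Ux] j := ultrafilter_limit (fun T => (p T).1 j) UU.
have /choice[x' Ux'] j := ultrafilter_limit (fun T => (p T).2 j) UU.
have limU (z : I -> A) (q : {fset I} -> I -> A) j :
    (forall k, U [set T | q T k = z k]%classic) ->
    U [set T | tau (q T) j = tau z j]%classic.
  move=> Uz; have [S SP] := tau_loc j.
  have US : U (\bigcap_(k in [set` S]) [set T | q T k = z k])%classic.
    by apply: filter_bigI => k _; exact: Uz.
  by apply: filterS US => T TS; apply: SP => k kS; exact: TS.
have xx' : x = x'.
  apply: (can_inj tauK); apply/funext => j.
  have [T [[<- <-] jT]] := filter_ex (filterI
    (filterI (limU _ _ j Ux) (limU _ _ j Ux')) (Utail [fset j]%fset)).
  by apply: (pP T).1; move: jT; rewrite /= fsub1set.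
have [T [/= xT x'T]] := filter_ex (filterI (Ux i) (Ux' i)).
by apply: (pP T).2; rewrite xT x'T xx'.
Qed.

End Local.

(** * Cellular automata as equivariant local maps *)

Section CellularAutomata.
Variables (G : groupType) (A : finType).
Implicit Types (phi psi : {multiplicative G -> G}) (x y : G -> A).
Implicit Types (tau sigma : (G -> A) -> (G -> A)).

Lemma gshiftE g x h : gshift g x h = x (g^-1 * h).
Proof. by []. Qed.

Definition equivariant phi tau :=
  forall g x, tau (gshift (phi g) x) = gshift g (tau x).

(** Equivariance reduces [tau x g] to the value at [1] of a translate of [x];
    the rule [mu] is then that value, computed on the pattern extended to all
    of [G] by the symbol [a0].  Conversely, the cell [g] of an automaton with
    memory set [S] reads the cells in [phi g * S]. *)
Lemma caP (a0 : A) phi tau :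
  cellular_automaton phi tau <-> equivariant phi tau /\ local tau.
Proof.
split=> [[S [mu tauE]]|[tau_eq tau_loc]].
  split=> [g x|g].
    apply/funext => h; rewrite gshiftE !tauE; congr mu; apply/funext => s.
    rewrite /restriction !gshiftE; congr x.
    by rewrite -!(groupmorphV gmulfM) !invgK gmulfM -mulgA (groupmorphV gmulfM).
  exists [fset phi g * s | s in S]%fset => x y xy.
  rewrite !tauE; congr mu; apply/funext => s.
  rewrite /restriction !gshiftE -(groupmorphV gmulfM) invgK; apply: xy.
  by apply/imfsetP; exists (val s) => //=; exact: valP.
have [S SP] := tau_loc 1.
pose extend (p : S -> A) : G -> A := fun h => oapp p a0 (insub h).
exists S, (fun p => tau (extend p) 1) => x g.
transitivity (tau (gshift (phi g^-1) x) 1).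
  by rewrite tau_eq gshiftE invgK mulg1.
by apply: SP => s sS; rewrite /extend insubT.
Qed.

(** The maps on [G] compose in the opposite order:
    [tau (sigma (gshift (psi (phi g)) x)) = tau (gshift (phi g) (sigma x))]. *)
Lemma ca_comp (a0 : A) phi psi (chi : {multiplicative G -> G}) tau sigma :
  chi =1 psi \o phi ->
  cellular_automaton phi tau -> cellular_automaton psi sigma ->
  cellular_automaton chi (tau \o sigma).
Proof.
move=> chiE /(caP a0)[tau_eq tau_loc] /(caP a0)[sigma_eq sigma_loc].
apply/(caP a0); split=> [g x|g] /=; first by rewrite chiE /= sigma_eq tau_eq.
exact: finitely_determined_comp (tau_loc g) sigma_loc.
Qed.

Lemma ca_inv (a0 : A) phi psi tau sigma :
  cancel psi phi -> cancel tau sigma -> cancel sigma tau ->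
  cellular_automaton phi tau -> cellular_automaton psi sigma.
Proof.
move=> psiK tauK sigmaK /(caP a0)[tau_eq tau_loc].
apply/(caP a0); split; last exact: local_inv tauK sigmaK tau_loc.
by move=> g x; rewrite -{1}(sigmaK x) -tau_eq psiK tauK.
Qed.

Lemma ca_id : cellular_automaton idfun (idfun : (G -> A) -> (G -> A)).
Proof.
have s1 : 1 \in [fset (1 : G)]%fset by rewrite inE.
exists [fset 1]%fset, (fun p => p [` s1]%fset) => x g.
by rewrite /restriction gshiftE invgK mulg1.
Qed.

Lemma ca_star phi : cellular_automaton phi (star_fun phi : (G -> A) -> _).
Proof.
have s1 : 1 \in [fset (1 : G)]%fset by rewrite inE.
exists [fset 1]%fset, (fun p => p [` s1]%fset) => x g.
by rewrite /restriction gshiftE -(groupmorphV gmulfM) invgK mulg1.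
Qed.

(** Translations carry the hypothesis at [1] to every other cell. *)
Lemma ca_fix1_id tau :
  cellular_automaton idfun tau -> (forall x, tau x 1 = x 1) -> tau = idfun.
Proof.
move=> [S [mu tauE]] fix1; apply/funext => x; apply/funext => g.
(* both sides are the value at 1 of the translate of x by g^-1 *)
have := fix1 (gshift g^-1 x); rewrite gshiftE invgK mulg1 /= => <-.
rewrite !tauE; congr mu; apply/funext => s.
by rewrite /restriction !gshiftE /= !invg1 !invgK mul1g.
Qed.

End CellularAutomata.

(** * The semidirect product *)

Section Groups.
Variables (G : groupType) (A : finType).

Lemma starM : {morph (star G A) : phi psi / phi * psi}.
Proof. by move=> phi psi; exact: symP. Qed.

Lemma star_inj : (2 <= #|A|)%N -> injective (star G A).
Proof.
move=> /card_gt1P[a [b [_ _ /eqP ab]]] phi psi e; apply/autP/funext => g.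
apply: contrapT => neq; apply: ab.
(* the indicator of phi g separates star phi x from star psi x at g *)
pose x h := if h == phi g then a else b.
have /(congr1 (fun f : Sym (G -> A) => f x g)) := e.
by rewrite /= /star_fun /x /= eqxx; case: eqP => // /esym.
Qed.

Lemma subgroupP (H : groupType) (K : set H) :
  subgroup K <-> K 1 /\ forall f g, K f -> K g -> K (f * g^-1).
Proof.
split=> [[K1 KB]|[K1 KB]]; split.
- by move: K1; rewrite inE.
- by move=> f g Kf Kg; have := KB f g; rewrite !inE; exact.
- by rewrite inE.
- by move=> f g; rewrite !inE; exact: KB.
Qed.

Lemma subgroup_star : subgroup (range (star G A)).
Proof.
apply/subgroupP; split; first by exists 1; rewrite ?(groupmorph1 starM).
move=> _ _ [phi _ <-] [psi _ <-].
by exists (phi * psi^-1); rewrite // starM (groupmorphV starM).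
Qed.

(** Stated for any right inverse [psi] of [phi], so that it serves both
    [idfun] and the inverse of an automorphism. *)
Lemma ca_symV (a0 : A) (phi psi : {multiplicative G -> G})
    (tau : Sym (G -> A)) :
  cancel psi phi -> cellular_automaton phi tau -> cellular_automaton psi tau^-1.
Proof.
move=> psiK; have [tauK tauVK] := symVK tau.
exact: (ca_inv a0 psiK tauK tauVK).
Qed.

Lemma subgroup_ICA (a0 : A) : subgroup (ICA G A).
Proof.
apply/subgroupP; split=> [|f g fP gP]; first exact: ca_id.
by apply: (ca_comp a0 _ fP (ca_symV a0 (psi := idfun) _ gP)).
Qed.

Lemma subgroup_IGCA (a0 : A) : subgroup (IGCA G A).
Proof.
apply/subgroupP; split=> [|f g [phi fP] [psi gP]].
  by exists 1; exact: ca_id.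
exists (psi^-1 * phi).
by apply: (ca_comp a0 _ fP (ca_symV a0 (autVK psi).2 gP)).
Qed.

Lemma ICA_normal (a0 : A) : normal_in (ICA G A) (IGCA G A).
Proof.
move=> k n [phi kP] nP.
have knP : cellular_automaton phi (k * n) by apply: (ca_comp a0 _ kP nP).
apply: (ca_comp a0 _ knP (ca_symV a0 (autVK phi).2 kP)) => g.
by rewrite /= (autVK phi).1.
Qed.

(** [tau = (tau * star phi^-1) * star phi], where the first factor is an
    automaton for [phi^-1 \o phi = id]. *)
Lemma IGCA_mul (a0 : A) :
  IGCA G A = [set n * b | n in ICA G A & b in range (star G A)]%classic.
Proof.
apply/seteqP; split=> [tau [phi tauP]|_ [n nP [_ [phi _ <-] <-]]]; last first.
  by exists phi; apply: (ca_comp a0 _ nP (ca_star A phi)).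
pose phi' : opposite (Aut G) := phi.
exists (tau * star G A phi'^-1); last first.
  by exists (star G A phi') => //; rewrite (groupmorphV starM) mulgVK.
apply: (ca_comp a0 _ tauP (ca_star A (phi^-1 : Aut G))) => g.
by rewrite /= (autVK phi).1.
Qed.

Lemma ICA_star_trivI : (ICA G A `&` range (star G A) = [set 1])%classic.
Proof.
apply/seteqP; split=> [f [nP [phi _ fE]]|_ ->]; last first.
  by split; [exact: ca_id | exists 1; rewrite ?(groupmorph1 starM)].
apply/symP/(ca_fix1_id nP) => x.
by rewrite -fE /= /star_fun /= (groupmorph1 gmulfM).
Qed.

End Groups.

Theorem theorem4 (G : groupType) (A : finType) (hA : (2 <= #|A|)%N) :
  [/\ injective (star G A),
      {morph (star G A) : phi psi / (phi * psi)%g} &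
      semidirect_product (IGCA G A) (ICA G A) (range (star G A))].
Proof.
have [a0 _] : exists a, a \in A by apply/card_gt0P; exact: ltnW.
split; [exact: star_inj | exact: starM | split].
- exact: subgroup_IGCA.
- by split; [exact: subgroup_ICA | move=> n nP; exists 1].
- split; first exact: subgroup_star.
  by move=> _ [phi _ <-]; exists phi; exact: ca_star.
- exact: IGCA_mul.
- exact: ICA_normal.
- exact: ICA_star_trivI.
Qed.
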